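(* Let $X$ and $Y$ be two smooth complex projective varieties, let $L$ be a line bundle on $X$ and $M$ a line bundle on $Y$. Let $\pi_X: X\times Y\to X$ and $\pi_Y: X\times Y\to Y$ be the canonical projections. Suppose $L$ and $M$ satisfy Property $N_1$. Let $p\geq 2$ be an integer. If $L$ does not satisfy Property $N_p$, then $\pi_X^*L\otimes\pi_Y^*M$ does not satisfy Property $N_p$ either.
   Context: Property $N_p$ (Green–Lazarsfeld), $p\in\mathbf{N}=\{0,1,2,\dots\}$: let $Z$ be a smooth complex projective variety and $A$ a very ample line bundle on $Z$, defining an embedding $Z\hookrightarrow \mathbf{P}(H^0(Z,A)^* )$. Let $S=\mathrm{Sym}^* H^0(Z,A)$ be the homogeneous coordinate ring of this projective space, and let $G=\bigoplus_{n} H^0(Z,A^{n})$, a graded $S$-module. Let $$0\to E_n\to E_{n-1}\to\cdots\to E_0\to G\to 0$$ be a minimal graded free resolution of $G$ over $S$. Then $A$ satisfies Property $N_p$ if and only if $E_0=S$ and, for every $1\le i\le p$, $E_i$ is a (possibly zero) direct sum of copies of $S(-i-1)$. (In particular, a line bundle satisfying Property $N_1$ is understood to be very ample.) *)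

(* Defs.v *)
(* Importing more of MathComp-Analysis than [reals] (used for C = R[i], with
   R : realType) clashes with the notations of mpoly. *)
From HB Require Import structures.
From mathcomp Require Import all_boot all_order all_algebra.
From mathcomp Require Import reals complex mpoly.

Set Implicit Arguments.
Unset Strict Implicit.
Unset Printing Implicit Defensive.

Import GRing.Theory.
Local Open Scope ring_scope.

(** * Projective varieties *)

(* A point of P^(n-1) is handled through its representatives, the nonzero
   vectors of K^n: a subset of P^(n-1) is a set of nonzero vectors that is
   stable under nonzero scaling (which [zclosed] forces). *)
Definition pset (K : fieldType) (n : nat) := 'rV[K]_n -> Prop.

Definition subpset {K : fieldType} {n : nat} (A B : pset K n) : Prop :=
  forall z, A z -> B z.

Definition same_point {K : fieldType} {n : nat} (u v : 'rV[K]_n) : Prop :=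
  exists c : K, c != 0 /\ v = c *: u.

Definition peval {K : fieldType} {n : nat} (F : {mpoly K[n]}) (z : 'rV[K]_n) : K :=
  F.@[z 0].

Definition zclosed {K : fieldType} {n : nat} (C : pset K n) : Prop :=
  exists E : {mpoly K[n]} -> Prop,
    (forall F, E F -> exists d : nat, F \is d.-homog) /\
    (forall z, C z <-> z != 0 /\ (forall F, E F -> peval F z = 0)).

(* Only the trace of U on Z matters. *)
Definition open_in {K : fieldType} {n : nat} (Z U : pset K n) : Prop :=
  exists C : pset K n, zclosed C /\ (forall z, Z z -> (U z <-> ~ C z)).

Definition irreducible {K : fieldType} {n : nat} (Z : pset K n) : Prop :=
  (exists z, Z z) /\
  (forall A B : pset K n, zclosed A -> zclosed B ->
     (forall z, Z z -> A z \/ B z) -> subpset Z A \/ subpset Z B).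

Definition projective_variety {K : fieldType} {n : nat} (Z : pset K n) : Prop :=
  zclosed Z /\ irreducible Z.

(* There is a chain of length d of irreducible closed subsets of Z. *)
Definition has_chain {K : fieldType} {n : nat} (Z : pset K n) (d : nat) : Prop :=
  exists c : nat -> pset K n,
    (forall i, (i <= d)%N -> projective_variety (c i) /\ subpset (c i) Z) /\
    (forall i, (i < d)%N -> subpset (c i) (c i.+1) /\ ~ subpset (c i.+1) (c i)).

Definition has_dimension {K : fieldType} {n : nat} (Z : pset K n) (d : nat) : Prop :=
  has_chain Z d /\ ~ has_chain Z d.+1.

(* The Zariski tangent space at z of the affine cone over Z. *)
Definition cone_tangent {K : fieldType} {n : nat} (Z : pset K n) (z v : 'rV[K]_n) : Prop :=
  forall (e : nat) (F : {mpoly K[n]}), F \is e.-homog ->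
    (forall w, Z w -> peval F w = 0) ->
    \sum_(k < n) peval F^`M(k) z * v 0 k = 0.

(* Jacobian criterion; the dimension is d + 1 because it is that of the cone. *)
Definition smooth {K : fieldType} {n : nat} (Z : pset K n) : Prop :=
  exists d : nat, has_dimension Z d /\
    forall z, Z z -> exists T : 'M[K]_n,
      \rank T = d.+1 /\ (forall v : 'rV[K]_n, (v <= T)%MS <-> cone_tangent Z z v).

Definition smooth_projective_variety {K : fieldType} {n : nat} (Z : pset K n) : Prop :=
  projective_variety Z /\ smooth Z.

(** * Regular functions and morphisms *)

(* f is regular on the open subset U of Z: locally a quotient of two
   homogeneous polynomials of the same degree. *)
Definition regular {K : fieldType} {n : nat} (Z U : pset K n) (f : 'rV[K]_n -> K) : Prop :=
  forall z, Z z -> U z ->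
    exists V : pset K n, [/\ open_in Z V, V z &
      exists (d : nat) (P Q : {mpoly K[n]}),
        [/\ P \is d.-homog, Q \is d.-homog &
            forall w, Z w -> U w -> V w ->
              peval Q w != 0 /\ f w = peval P w / peval Q w]].

Definition morphism {K : fieldType} {m n : nat} (W : pset K m) (Z : pset K n)
    (f : 'rV[K]_m -> 'rV[K]_n) : Prop :=
  (forall w, W w -> Z (f w)) /\
  (forall U : pset K n, open_in Z U ->
     open_in W (fun w => U (f w)) /\
     (forall g, regular Z U g ->
        regular W (fun w => U (f w)) (fun w => g (f w)))).

(* f is an isomorphism of Z onto a closed subvariety of P^(r-1). *)
Definition closed_embedding {K : fieldType} {n r : nat} (Z : pset K n)
    (f : 'rV[K]_n -> 'rV[K]_r) : Prop :=
  let W : pset K r := fun w => exists z, Z z /\ same_point (f z) w in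
  [/\ zclosed W, morphism Z W f &
      exists g : 'rV[K]_r -> 'rV[K]_n,
        morphism W Z g /\ (forall z, Z z -> same_point z (g (f z)))].

(** * Line bundles *)

(* Line bundles are given by transition functions [trans i j] on the overlaps
   of a trivializing open cover [chart]. *)
Record cocycle (K : fieldType) (n : nat) : Type := Cocycle {
  idx : Type;
  chart : idx -> pset K n;
  trans : idx -> idx -> 'rV[K]_n -> K }.

Definition line_bundle {K : fieldType} {n : nat} (Z : pset K n) (A : cocycle K n) : Prop :=
  [/\ forall i : idx A, open_in Z (chart i),
      forall z, Z z -> exists i : idx A, chart i z,
      forall i j : idx A, regular Z (fun z => chart i z /\ chart j z) (trans i j),
      forall (i : idx A) z, Z z -> chart i z -> trans i i z = 1 &
      forall (i j k : idx A) z, Z z -> chart i z -> chart j z -> chart k z ->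
        trans i j z * trans j k z = trans i k z].

Definition tensor {K : fieldType} {n : nat} (A B : cocycle K n) : cocycle K n :=
  Cocycle (fun (i : idx A * idx B) z => chart i.1 z /\ chart i.2 z)
          (fun i j z => trans i.1 j.1 z * trans i.2 j.2 z).

Definition power {K : fieldType} {n : nat} (A : cocycle K n) (k : nat) : cocycle K n :=
  Cocycle (@chart K n A) (fun i j z => trans i j z ^+ k).

Definition pullback {K : fieldType} {m n : nat} (f : 'rV[K]_m -> 'rV[K]_n)
    (A : cocycle K n) : cocycle K m :=
  Cocycle (fun (i : idx A) z => chart i (f z)) (fun i j z => trans i j (f z)).

(* The family of local expressions of a section in the trivializations. *)
Definition local_exprs {K : fieldType} {n : nat} (A : cocycle K n) : Type :=
  idx A -> 'rV[K]_n -> K.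

(* s is an element of H^0(Z, A). *)
Definition is_section {K : fieldType} {n : nat} (Z : pset K n) (A : cocycle K n)
    (s : local_exprs A) : Prop :=
  (forall i, regular Z (chart i) (s i)) /\
  (forall i j z, Z z -> chart i z -> chart j z -> s i z = trans i j z * s j z).

Arguments is_section {K n} Z A s.

Definition eq_section {K : fieldType} {n : nat} (Z : pset K n) (A : cocycle K n)
    (s t : local_exprs A) : Prop :=
  forall i z, Z z -> chart i z -> s i z = t i z.

Definition lincomb {K : fieldType} {n r : nat} (A : cocycle K n) (c : 'I_r -> K)
    (s : 'I_r -> local_exprs A) : local_exprs A :=
  fun i z => \sum_(k < r) c k * s k i z.

Definition section_basis {K : fieldType} {n r : nat} (Z : pset K n) (A : cocycle K n)
    (s : 'I_r -> local_exprs A) : Prop :=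
  [/\ forall k, is_section Z A (s k),
      forall t : local_exprs A, is_section Z A t ->
        exists c : 'I_r -> K, eq_section Z t (lincomb c s) &
      forall c : 'I_r -> K,
        eq_section Z (lincomb c s) (fun _ _ => 0) -> forall k, c k = 0].

(* The existence of f with [same_point] contains base point freeness, as
   [closed_embedding] makes f z nonzero. *)
Definition very_ample {K : fieldType} {n : nat} (Z : pset K n) (A : cocycle K n) : Prop :=
  exists (r : nat) (s : 'I_r -> local_exprs A) (f : 'rV[K]_n -> 'rV[K]_r),
    [/\ section_basis Z s,
        forall (i : idx A) z, Z z -> chart i z ->
          same_point (\row_(k < r) s k i z) (f z) &
        closed_embedding Z f].

(** * Minimal graded free resolutions of the section module *)

(* F belongs to the degree d part of S(-a), where S = K[T_0, .., T_(r-1)]. *)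
Definition twist_homog {K : fieldType} {r : nat} (a d : nat) (F : {mpoly K[r]}) : Prop :=
  forall m, m \in msupp F -> (a + mdeg m)%N = d.

(* A sequence of graded free modules E_i = \bigoplus_j S(-(twist i j)) of finite
   rank, elements being row vectors, with maps u |-> u *m diff i from E_(i+1) to
   E_i.  Twists are natural numbers: a minimal resolution of a module that
   vanishes in negative degrees has its generators in nonnegative degrees. *)
Record free_complex (K : fieldType) (r : nat) : Type := FreeComplex {
  rk : nat -> nat;
  twist : forall i, 'I_(rk i) -> nat;
  diff : forall i, 'M[{mpoly K[r]}]_(rk i.+1, rk i) }.

(* v is a homogeneous element of degree d of E_i. *)
Definition homog_elt {K : fieldType} {r : nat} (E : free_complex K r) (i d : nat)
    (v : 'rV[{mpoly K[r]}]_(rk E i)) : Prop :=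
  forall j, twist_homog (twist j) d (v 0 j).

(* The map E_0 -> \bigoplus_k H^0(Z, A^k) sending the j-th generator to g j,
   where the variable T_k acts as multiplication by the section s k. *)
Definition augmentation {K : fieldType} {n r : nat} (A : cocycle K n)
    (s : 'I_r -> local_exprs A) (E : free_complex K r)
    (g : 'I_(rk E 0) -> local_exprs A) (v : 'rV[{mpoly K[r]}]_(rk E 0)) :
    local_exprs A :=
  fun i z => \sum_j (v 0 j).@[fun k => s k i z] * g j i z.

(* E, augmented by g, is a minimal graded free resolution of
   G = \bigoplus_(k >= 0) H^0(Z, A^k) over S = Sym H^0(Z, A), the polynomial
   ring on the basis s.  Exactness is stated degree by degree. *)
Definition minimal_resolution {K : fieldType} {n r : nat} (Z : pset K n)
    (A : cocycle K n) (s : 'I_r -> local_exprs A) (E : free_complex K r)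
    (g : 'I_(rk E 0) -> local_exprs A) : Prop :=
  (exists N : nat, forall i, (N < i)%N -> rk E i = 0%N) /\
  (* the maps are graded of degree 0 *)
  (forall i j k, twist_homog (twist k) (twist j) (diff E i j k)) /\
  (forall j, is_section Z (power A (twist j)) (g j)) /\
  (* minimality: E_(i+1) is mapped into (T_0, .., T_(r-1)) E_i *)
  (forall i j k, (diff E i j k)@_0%MM = 0) /\
  (* exactness at G, E_0 and E_(i+1) *)
  (forall d (t : local_exprs A), is_section Z (power A d) t ->
     exists v, homog_elt (E := E) d v /\ eq_section Z t (augmentation s g v)) /\
  (forall d v, homog_elt (E := E) (i := 0) d v ->
     (eq_section Z (augmentation s g v) (fun _ _ => 0) <->
      exists u, homog_elt (E := E) d u /\ v = u *m diff E 0)) /\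
  (forall i d v, homog_elt (E := E) (i := i.+1) d v ->
     (v *m diff E i = 0 <->
      exists u, homog_elt (E := E) d u /\ v = u *m diff E i.+1)).

(* Property N_p.  Minimal resolutions being unique up to isomorphism, it does
   not matter which one is considered. *)
Definition property_N {K : fieldType} {n : nat} (p : nat) (Z : pset K n)
    (A : cocycle K n) : Prop :=
  very_ample Z A /\
  exists (r : nat) (s : 'I_r -> local_exprs A) (E : free_complex K r)
         (g : 'I_(rk E 0) -> local_exprs A),
    [/\ section_basis Z s,
        minimal_resolution Z s g,
        rk E 0 = 1%N /\ (forall j : 'I_(rk E 0), twist j = 0%N) &
        forall i, (1 <= i <= p)%N -> forall j : 'I_(rk E i), twist j = i.+1].

(** * Products *)

(* The product variety, as a closed subset of P(K^m (x) K^n) through the Segre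
   embedding; the vector mxvec (x^T *m y) has coordinates x_i * y_j. *)
Definition segre_product {K : fieldType} {m n : nat} (X : pset K m) (Y : pset K n) :
    pset K (m * n) :=
  fun z => exists x y, [/\ X x, Y y & z = mxvec (x^T *m y)].

(* The projections: on the class of x^T *m y, any nonzero column represents the
   point x, and any nonzero row represents the point y. *)
Definition proj_fst {K : fieldType} {m n : nat} (z : 'rV[K]_(m * n)) : 'rV[K]_m :=
  if [pick j | col j (vec_mx z) != 0] is Some j then (col j (vec_mx z))^T else 0.

Definition proj_snd {K : fieldType} {m n : nat} (z : 'rV[K]_(m * n)) : 'rV[K]_n :=
  if [pick i | row i (vec_mx z) != 0] is Some i then row i (vec_mx z) else 0.

Lemma proj_fst_segre (K : fieldType) (m n : nat) (x : 'rV[K]_m) (y : 'rV[K]_n) :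
  x != 0 -> y != 0 ->
  same_point x (proj_fst (mxvec (x^T *m y))).
Proof.
move=> x0 y0; rewrite /proj_fst mxvecK.
have E j : (col j (x^T *m y))^T = y 0 j *: x.
  by apply/rowP=> i; rewrite !mxE big_ord1 !mxE mulrC.
case: pickP=> [j h|h].
  exists (y 0 j); split; last exact: E.
  apply: contraNneq h => h; apply/eqP/trmx_inj; by rewrite E h scale0r trmx0.
case/negP: y0; apply/eqP/rowP=> j; rewrite mxE.
have := h j => /negbFE/eqP/(congr1 trmx); rewrite E trmx0 => /eqP.
by rewrite scaler_eq0 (negPf x0) orbF => /eqP.
Qed.

Lemma proj_snd_segre (K : fieldType) (m n : nat) (x : 'rV[K]_m) (y : 'rV[K]_n) :
  x != 0 -> y != 0 ->
  same_point y (proj_snd (mxvec (x^T *m y))).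
Proof.
move=> x0 y0; rewrite /proj_snd mxvecK.
have E j : row j (x^T *m y) = x 0 j *: y.
  by apply/rowP=> i; rewrite !mxE big_ord1 !mxE.
case: pickP=> [j h|h].
  exists (x 0 j); split; last exact: E.
  by apply: contraNneq h => h; rewrite E h scale0r.
case/negP: x0; apply/eqP/rowP=> j; rewrite mxE.
have := h j => /negbFE/eqP; rewrite E => /eqP.
by rewrite scaler_eq0 (negPf y0) orbF => /eqP.
Qed.

(* Main.v *)
Require Import Defs.
From HB Require Import structures.
From mathcomp Require Import all_boot all_order all_algebra.
From mathcomp Require Import reals complex mpoly.
From mathcomp Require Import ring.

(** Write G(L) for the graded ring of sections of the powers of L, and P for the
line bundle on the product.  The contrapositive is proved: N_p for P gives N_p
for L.  The reason is that G(L) is a graded retract of G(P).  Choose a point y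
of Y and a section b of M with value 1 at y; one exists because M is very ample.
In degree d, multiplying the pullback of a section of L^d by b^d gives a section
of P^d, and restricting sections of P^d to the slice X x {y} brings the original
section back.  No Kuenneth formula is needed, since only these two maps of
section rings are used, not the shape of G(P).

Both maps are instances of one construction: a morphism W -> Z together with a
map of line bundles over it ([bundle_map]) pulls sections back
([is_section_pullback]), hence acts on the degree one parts by a matrix, which
defines a linear substitution ([lsub]) between the two polynomial rings, and the
map of section rings lifts to the degree zero terms of free resolutions
([section_pullback_lift]).

The rest is the comparison theorem for resolutions.  Let E be a minimal
resolution of G(L), which N_1 for L provides with E_0 = S, and F one of G(P).  The two ring maps lift to chain
maps E -> F and F -> E, semilinear over the two substitutions; as the composite
of the substitutions is the identity, the composite E -> E is linear and lifts
the identity of G(L), so it is homotopic to the identity ([retract_step]).  The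
differentials of E have no constant terms, so modulo the irrelevant ideal the
composite E_i -> F_i -> E_i is the identity.  The chain maps have degree zero,
so every generator of E_i must meet a generator of F_i of the same degree
([retract_twist]): the degrees of the generators of E_i occur among those of
F_i ([twist_of_retract]).  If the latter are all equal to i + 1, so are the
former. *)

Set Implicit Arguments.
Unset Strict Implicit.
Import GRing.Theory.
Local Open Scope ring_scope.

(** * Linear substitutions and graded matrices *)

(** The ring map of Sym V -> Sym W induced by a linear map V -> W with matrix A:
the rows of A are the images of the variables. *)
Definition lsub {K : fieldType} {a b : nat} (A : 'M[K]_(a, b)) :
    {mpoly K[a]} -> {mpoly K[b]} :=
  comp_mpoly [tuple \sum_l A k l *: 'X_l | k < a].

HB.instance Definition _ (K : fieldType) (a b : nat) (A : 'M[K]_(a, b)) :=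
  GRing.RMorphism.copy (lsub A) (comp_mpoly [tuple \sum_l A k l *: 'X_l | k < a]).

Lemma lsub_meval {K : fieldType} {a b : nat} (A : 'M[K]_(a, b))
    (p : {mpoly K[a]}) (v : 'I_b -> K) :
  (lsub A p).@[v] = p.@[fun k => \sum_l A k l * v l].
Proof.
rewrite comp_mpoly_meval; apply: meval_eq => k; rewrite tnth_mktuple raddf_sum /=.
by apply: eq_bigr => l _; rewrite mevalZ mevalXU.
Qed.

Lemma lsub_dhomog {K : fieldType} {a b : nat} (A : 'M[K]_(a, b)) (d : nat)
    (p : {mpoly K[a]}) : p \is d.-homog -> lsub A p \is d.-homog.
Proof.
move=> /dhomogP hp; rewrite /lsub comp_mpolyE big_seq; apply: rpred_sum => m mp.
apply: rpredZ; rewrite -(hp _ mp) /= mdegE.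
elim/big_rec2: _ => [|k e q _ hq]; first exact: dhomog1.
apply: dhomogM hq; rewrite tnth_mktuple -[X in X.-homog]mul1n; apply: dhomogMn.
by apply: rpred_sum => l _; apply: rpredZ; rewrite dhomogX /= mdeg1.
Qed.

Lemma lsubE {K : fieldType} {a b : nat} (A : 'M[K]_(a, b)) (p : {mpoly K[a]}) :
  lsub A p = \sum_(m <- msupp p) p@_m *: \prod_k (\sum_l A k l *: 'X_l) ^+ m k.
Proof.
rewrite /lsub comp_mpolyE; apply: eq_bigr => m _; congr (_ *: _).
by apply: eq_bigr => k _; rewrite tnth_mktuple.
Qed.

Lemma lsubZ {K : fieldType} {a b : nat} (A : 'M[K]_(a, b)) (c : K) (p : {mpoly K[a]}) :
  lsub A (c *: p) = c *: lsub A p.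
Proof. exact: comp_mpolyZ. Qed.

Lemma lsubX {K : fieldType} {a b : nat} (A : 'M[K]_(a, b)) (k : 'I_a) :
  lsub A 'X_k = \sum_l A k l *: 'X_l.
Proof. by rewrite /lsub comp_mpolyXU -tnth_nth tnth_mktuple. Qed.

Lemma lsubK {K : fieldType} {a b : nat} (A : 'M[K]_(a, b)) (B : 'M[K]_(b, a)) :
  A *m B = 1%:M -> cancel (lsub A) (lsub B).
Proof.
move=> AB p; rewrite (lsubE A p) raddf_sum [RHS]mpolyE /=.
apply: eq_bigr => m _; rewrite lsubZ; congr (_ *: _).
rewrite rmorph_prod mpolyXE_id; apply: eq_bigr => k _; rewrite rmorphXn /=; congr (_ ^+ _).
rewrite raddf_sum /=.
transitivity (\sum_l \sum_j (A k l * B l j) *: ('X_j : {mpoly K[a]})).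
  apply: eq_bigr => l _; rewrite lsubZ lsubX.
  by rewrite scaler_sumr; apply: eq_bigr => j _; rewrite scalerA.
transitivity (\sum_j (1%:M : 'M_a) k j *: ('X_j : {mpoly K[a]})).
  rewrite exchange_big; apply: eq_bigr => j _.
  by rewrite -AB mxE scaler_suml.
rewrite (bigD1 k) //= big1 ?addr0 ?mxE ?eqxx ?scale1r // => j jk.
by rewrite mxE eq_sym (negPf jk) scale0r.
Qed.

Lemma meval_dhomog {K : fieldType} {a : nat} (d : nat) (p : {mpoly K[a]})
    (c : K) (v : 'I_a -> K) :
  p \is d.-homog -> p.@[fun k => c * v k] = c ^+ d * p.@[v].
Proof.
move=> /dhomogP hp; rewrite !mevalE big_distrr /= big_seq [RHS]big_seq.
apply: eq_bigr => m mp; rewrite mulrCA; congr (_ * _).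
rewrite -(hp _ mp) /= mdegE -prodrXr -big_split /=.
by apply: eq_bigr => k _; rewrite exprMn.
Qed.

Lemma twist_homogP {K : fieldType} {r : nat} (b d : nat) (p : {mpoly K[r]}) :
  twist_homog b d p <-> (if (b <= d)%N then p \is (d - b).-homog else p == 0).
Proof.
rewrite /twist_homog; split=> [h|].
  case: leqP => [bd|db].
    by apply/dhomogP => m /h <-; rewrite addKn.
  rewrite -msupp_eq0; case: (msupp p) h => // m s h.
  by have := leq_addr (mdeg m) b; rewrite (h m (mem_head m s)) leqNgt db.
case: leqP => [bd /dhomogP h m /h /= ->|_ /eqP -> m]; first by rewrite subnKC.
by rewrite msupp0.
Qed.

Lemma twist_homog_lsub {K : fieldType} {a b : nat} (A : 'M[K]_(a, b)) (e d : nat)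
    (p : {mpoly K[a]}) : twist_homog e d p -> twist_homog e d (lsub A p).
Proof.
rewrite !twist_homogP; case: leqP => [_|_ /eqP ->]; last by rewrite raddf0.
exact: lsub_dhomog.
Qed.

Lemma twist_homogM {K : fieldType} {r : nat} (a b c : nat) (p q : {mpoly K[r]}) :
  twist_homog b a p -> twist_homog c b q -> twist_homog c a (p * q).
Proof.
move=> hp hq m /msuppM_le /allpairsP [[m1 m2] /= [/hp <- /hq <- ->]].
by rewrite mdegD addnA addnAC.
Qed.

Lemma twist_homogD {K : fieldType} {r : nat} (a b : nat) (p q : {mpoly K[r]}) :
  twist_homog b a p -> twist_homog b a q -> twist_homog b a (p + q).
Proof.
by move=> hp hq m /msuppD_le; rewrite mem_cat => /orP [/hp|/hq].
Qed.

Lemma twist_homogN {K : fieldType} {r : nat} (a b : nat) (p : {mpoly K[r]}) :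
  twist_homog b a p -> twist_homog b a (- p).
Proof. by move=> hp m; rewrite (perm_mem (msuppN p)) => /hp. Qed.

Lemma twist_homog0 {K : fieldType} {r : nat} (a b : nat) :
  twist_homog b a (0 : {mpoly K[r]}).
Proof. by move=> m; rewrite msupp0. Qed.

Lemma twist_homog_sum {K : fieldType} {r : nat} (a b : nat) (I : finType)
    (p : I -> {mpoly K[r]}) :
  (forall k, twist_homog b a (p k)) -> twist_homog b a (\sum_k p k).
Proof.
move=> hp; apply: (big_ind (fun x => twist_homog b a x)) => [|x y|k _].
- exact: twist_homog0.
- exact: twist_homogD.
- exact: hp.
Qed.

(** The matrices of degree zero maps from the sum of the S(-a j) to the sum of the
S(-b k). *)
Definition graded_mx {K : fieldType} {r p q : nat} (a : 'I_p -> nat) (b : 'I_q -> nat)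
    (N : 'M[{mpoly K[r]}]_(p, q)) : Prop :=
  forall j k, twist_homog (b k) (a j) (N j k).

Lemma graded_mxM {K : fieldType} {r p q t : nat} (a : 'I_p -> nat) (b : 'I_q -> nat)
    (c : 'I_t -> nat) (N : 'M[{mpoly K[r]}]_(p, q)) (N' : 'M_(q, t)) :
  graded_mx a b N -> graded_mx b c N' -> graded_mx a c (N *m N').
Proof.
move=> h h' j k; rewrite mxE; apply: twist_homog_sum => l.
exact: twist_homogM (h j l) (h' l k).
Qed.

Lemma graded_mxB {K : fieldType} {r p q : nat} (a : 'I_p -> nat) (b : 'I_q -> nat)
    (N N' : 'M[{mpoly K[r]}]_(p, q)) :
  graded_mx a b N -> graded_mx a b N' -> graded_mx a b (N - N').
Proof.
move=> h h' j k; rewrite !mxE; apply: twist_homogD (h j k) _.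
exact: twist_homogN (h' j k).
Qed.

Lemma graded_mx1 {K : fieldType} {r p : nat} (a : 'I_p -> nat) :
  graded_mx a a (1%:M : 'M[{mpoly K[r]}]_p).
Proof.
move=> j k; rewrite mxE; case: eqP => [->|_]; last exact: twist_homog0.
by move=> m; rewrite msupp1 inE => /eqP ->; rewrite mdeg0 addn0.
Qed.

Lemma graded_mx_lsub {K : fieldType} {r r' p q : nat} (A : 'M[K]_(r, r'))
    (a : 'I_p -> nat) (b : 'I_q -> nat) (N : 'M[{mpoly K[r]}]_(p, q)) :
  graded_mx a b N -> graded_mx a b (map_mx (lsub A) N).
Proof. by move=> h j k; rewrite mxE; apply: twist_homog_lsub. Qed.

Lemma graded_row {K : fieldType} {r p : nat} (E : free_complex K r) (i : nat)
    (a : 'I_p -> nat) (N : 'M_(p, rk E i)) (j : 'I_p) :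
  graded_mx a (@twist _ _ E i) N -> homog_elt (a j) (row j N).
Proof. by move=> h k; rewrite mxE. Qed.

(** * Comparison of resolutions *)

Lemma lift_rows {K : fieldType} {r q : nat} (E : free_complex K r) (i : nat)
    (a : 'I_q -> nat) (N : 'M_(q, rk E i)) :
  (forall j, exists u, homog_elt (E := E) (a j) u /\ row j N = u *m diff E i) ->
  exists U, graded_mx a (@twist _ _ E i.+1) U /\ N = U *m diff E i.
Proof.
move=> /fin_all_exists [u hu].
exists (\matrix_j u j); split=> [j k|].
  by rewrite mxE; have [h _] := hu j.
by apply/row_matrixP => j; rewrite row_mul rowK; have [_] := hu j.
Qed.


(** Exactness at E_0 is left out because it involves the augmentation. *)
Definition exact_complex {K : fieldType} {r : nat} (E : free_complex K r) : Prop :=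
  (forall i, graded_mx (@twist _ _ E i.+1) (@twist _ _ E i) (diff E i)) /\
  (forall i d v, homog_elt (E := E) (i := i.+1) d v ->
     (v *m diff E i = 0 <->
      exists u, homog_elt (E := E) d u /\ v = u *m diff E i.+1)).

Definition minimal_complex {K : fieldType} {r : nat} (E : free_complex K r) : Prop :=
  forall i j k, (diff E i j k)@_0%MM = 0.

Lemma exact_complex_dd {K : fieldType} {r : nat} (E : free_complex K r) (i : nat) :
  exact_complex E -> diff E i.+1 *m diff E i = 0.
Proof.
move=> [gr ex]; apply/row_matrixP => j; rewrite row_mul row0.
apply/(ex _ (twist j)); first exact: graded_row.
exists (row j 1%:M); split; first exact: graded_row (graded_mx1 _).
by rewrite -row_mul mul1mx.
Qed.

Lemma exact_complex_lift {K : fieldType} {r q : nat} (E : free_complex K r) (i : nat)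
    (a : 'I_q -> nat) (N : 'M_(q, rk E i.+1)) :
  exact_complex E -> graded_mx a (@twist _ _ E i.+1) N -> N *m diff E i = 0 ->
  exists U, graded_mx a (@twist _ _ E i.+2) U /\ N = U *m diff E i.+1.
Proof.
move=> [gr ex] hN N0; apply: lift_rows => j.
apply/(ex _ _ _ (graded_row hN)).
by rewrite -row_mul N0 row0.
Qed.

(** The state of the comparison at level i: f and g are the components of the chain
maps E -> F and F -> E, f' and g' the next ones, and h the component of the
homotopy.  The matrix t stands for the term of the homotopy formula that comes
from level i - 1 (zero for i = 0); of its shape only two consequences matter,
that it is killed by the next differential and has no constant terms.  Keeping
it abstract makes the induction start at i = 0 without a special case. *)
Definition retract_up_to_homotopy {K : fieldType} {a b : nat}
    (E : free_complex K a) (F : free_complex K b)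
    (A : 'M[K]_(a, b)) (B : 'M[K]_(b, a)) (i : nat) : Prop :=
  exists (f : 'M_(rk E i, rk F i)) (f' : 'M_(rk E i.+1, rk F i.+1))
         (g : 'M_(rk F i, rk E i)) (g' : 'M_(rk F i.+1, rk E i.+1))
         (h : 'M_(rk E i, rk E i.+1)) (t : 'M_(rk E i)),
    [/\ [/\ graded_mx (@twist _ _ E i) (@twist _ _ F i) f,
            graded_mx (@twist _ _ E i.+1) (@twist _ _ F i.+1) f',
            graded_mx (@twist _ _ F i) (@twist _ _ E i) g,
            graded_mx (@twist _ _ F i.+1) (@twist _ _ E i.+1) g' &
            graded_mx (@twist _ _ E i) (@twist _ _ E i.+1) h],
        map_mx (lsub A) (diff E i) *m f = f' *m diff F i,
        map_mx (lsub B) (diff F i) *m g = g' *m diff E i,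
        1%:M - map_mx (lsub B) f *m g = h *m diff E i + t &
        diff E i *m t = 0 /\ (forall j k, (t j k)@_0%MM = 0)].

Lemma mcoeff0_mulmx {K : fieldType} {r p q s : nat}
    (N : 'M[{mpoly K[r]}]_(p, q)) (N' : 'M[{mpoly K[r]}]_(q, s)) j k :
  ((N *m N') j k)@_0%MM = \sum_l (N j l)@_0%MM * (N' l k)@_0%MM.
Proof. by rewrite mxE raddf_sum; apply: eq_bigr => l _; rewrite /= (rmorphM (mcoeff 0%MM)). Qed.

(** The usual inductive construction of chain maps and homotopies.  The identity
A *m B = 1 enters once, to make g o f linear over the ring of E, so that it can
be compared with the identity of E. *)
Lemma retract_step {K : fieldType} {a b : nat}
    (E : free_complex K a) (F : free_complex K b)
    (A : 'M[K]_(a, b)) (B : 'M[K]_(b, a)) (i : nat) :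
  exact_complex E -> minimal_complex E -> exact_complex F -> A *m B = 1%:M ->
  retract_up_to_homotopy E F A B i -> retract_up_to_homotopy E F A B i.+1.
Proof.
move=> exE minE exF AB [f [f' [g [g' [h [t]]]]]].
move=> [[grf grf' grg grg' grh] eqf eqg htpy [dt t0]].
have [grE _] := exE; have [grF _] := exF.
have [f'' [grf'' eqf'']] : exists U, graded_mx (@twist _ _ E i.+2) (@twist _ _ F i.+2) U /\
    map_mx (lsub A) (diff E i.+1) *m f' = U *m diff F i.+1.
  apply: exact_complex_lift exF _ _.
    exact: graded_mxM (graded_mx_lsub (grE _)) grf'.
  by rewrite -mulmxA -eqf mulmxA -map_mxM exact_complex_dd // map_mx0 mul0mx.
have [g'' [grg'' eqg'']] : exists U, graded_mx (@twist _ _ F i.+2) (@twist _ _ E i.+2) U /\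
    map_mx (lsub B) (diff F i.+1) *m g' = U *m diff E i.+1.
  apply: exact_complex_lift exE _ _.
    exact: graded_mxM (graded_mx_lsub (grF _)) grg'.
  by rewrite -mulmxA -eqg mulmxA -map_mxM exact_complex_dd // map_mx0 mul0mx.
have [h' [grh' eqh']] : exists U, graded_mx (@twist _ _ E i.+1) (@twist _ _ E i.+2) U /\
    1%:M - map_mx (lsub B) f' *m g' - diff E i *m h = U *m diff E i.+1.
  apply: exact_complex_lift exE _ _.
    apply: graded_mxB (graded_mxM (grE _) grh).
    exact: graded_mxB (graded_mx1 _) (graded_mxM (graded_mx_lsub grf') grg').
  rewrite !mulmxBl mul1mx -mulmxA -eqg mulmxA -map_mxM -eqf map_mxM.
  have -> : map_mx (lsub B) (map_mx (lsub A) (diff E i)) = diff E i.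
    by apply/matrixP => j k; rewrite !mxE lsubK.
  have -> : diff E i *m h *m diff E i = diff E i *m (1%:M - map_mx (lsub B) f *m g - t).
    by rewrite htpy addrK mulmxA.
  by rewrite !mulmxBr mulmx1 dt subr0 mulmxA subrr.
exists f', f'', g', g'', h', (diff E i *m h); split=> //.
  by rewrite -eqh' subrK.
split; first by rewrite mulmxA exact_complex_dd // mul0mx.
by move=> j k; rewrite mcoeff0_mulmx big1 // => l _; rewrite minE mul0r.
Qed.

(** The diagonal constant term of g o f at j is 1, so that some entry f j k has a
nonzero constant term; as f has degree zero, this forces k and j to have the same
degree. *)
Lemma retract_twist {K : fieldType} {a b : nat}
    (E : free_complex K a) (F : free_complex K b)
    (A : 'M[K]_(a, b)) (B : 'M[K]_(b, a)) (i : nat) (j : 'I_(rk E i)) :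
  minimal_complex E -> retract_up_to_homotopy E F A B i ->
  exists k : 'I_(rk F i), twist k = twist j.
Proof.
move=> minE [f [f' [g [g' [h [t]]]]]] [[grf _ _ _ _] _ _ htpy [_ t0]].
have : ((map_mx (lsub B) f *m g) j j)@_0%MM != 0.
  have -> : map_mx (lsub B) f *m g = 1%:M - (h *m diff E i + t) by rewrite -htpy subKr.
  rewrite !mxE eqxx -[\sum_l _]/(\sum_l _).
  rewrite mcoeffB mcoeffD mcoeff1 eqxx t0 addr0 raddf_sum big1 ?subr0 ?oner_eq0 // => l _.
  by rewrite /= (rmorphM (mcoeff 0%MM)) /= minE mulr0.
have [k /eqP ek|ne] := pickP (fun k : 'I_(rk F i) => twist k == twist j).
  by exists k.
rewrite mcoeff0_mulmx big1 ?eqxx // => k _; rewrite mxE.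
case: (boolP (0%MM \in msupp (lsub B (f j k)))) => [|/memN_msupp_eq0 ->].
  move/(twist_homog_lsub (grf j k)); rewrite mdeg0 addn0 => e.
  by have := ne k; rewrite e eqxx.
by rewrite mul0r.
Qed.

(** * Closed sets and regular functions *)

Lemma same_point_sym {K : fieldType} {n : nat} (u v : 'rV[K]_n) :
  same_point u v -> same_point v u.
Proof.
move=> [c [c0 ->]]; exists c^-1; split; first by rewrite invr_eq0.
by rewrite scalerA mulVf // scale1r.
Qed.

Lemma peval_scale {K : fieldType} {n : nat} (d : nat) (F : {mpoly K[n]}) (c : K) z :
  F \is d.-homog -> peval F (c *: z) = c ^+ d * peval F z.
Proof.
move=> hF; rewrite /peval -(meval_dhomog _ _ hF); apply: meval_eq => k.
by rewrite mxE.
Qed.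

Lemma peval_lsub {K : fieldType} {m n : nat} (T : 'M[K]_(m, n)) (F : {mpoly K[n]}) w :
  peval (lsub T^T F) w = peval F (w *m T).
Proof.
rewrite /peval lsub_meval; apply: meval_eq => k; rewrite mxE.
by apply: eq_bigr => l _; rewrite mxE mulrC.
Qed.

Lemma peval_eq0 {K : fieldType} {n : nat} (d : nat) (F : {mpoly K[n]}) u v :
  F \is d.-homog -> same_point u v -> peval F u = 0 -> peval F v = 0.
Proof. by move=> hF [c [_ ->]] e; rewrite (peval_scale _ _ hF) e mulr0. Qed.

Lemma zclosed_neq0 {K : fieldType} {n : nat} (C : pset K n) z :
  zclosed C -> C z -> z != 0.
Proof. by move=> [E [_ hC]] /hC []. Qed.

Lemma zclosed_same_point {K : fieldType} {n : nat} (C : pset K n) u v :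
  zclosed C -> same_point u v -> C u -> C v.
Proof.
move=> [E [hE hC]] uv /hC [u0 Cu]; apply/hC; split.
  by have [c [c0 ->]] := uv; rewrite scaler_eq0 negb_or c0.
by move=> F EF; have [d hF] := hE F EF; apply: peval_eq0 hF uv _; apply: Cu.
Qed.

Lemma open_same_point {K : fieldType} {n : nat} (Z U : pset K n) u v :
  open_in Z U -> same_point u v -> Z u -> Z v -> U u -> U v.
Proof.
move=> [C [cC hU]] uv Zu Zv /(hU _ Zu) nC; apply/(hU _ Zv) => Cv; apply: nC.
exact: zclosed_same_point cC (same_point_sym uv) Cv.
Qed.

Lemma regular_same_point {K : fieldType} {n : nat} (Z U : pset K n) f u v :
  regular Z U f -> same_point u v -> Z u -> Z v -> U u -> U v -> f u = f v.
Proof.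
move=> rf uv Zu Zv Uu Uv; have [V [oV Vu [d [P [Q [hP hQ hf]]]]]] := rf u Zu Uu.
have Vv := open_same_point oV uv Zu Zv Vu.
have [_ ->] := hf u Zu Uu Vu; have [_ ->] := hf v Zv Uv Vv.
have [c [c0 ->]] := uv; rewrite (peval_scale _ _ hP) (peval_scale _ _ hQ).
by rewrite -mulf_div divff ?mul1r // expf_neq0.
Qed.

Lemma open_inT {K : fieldType} {n : nat} (Z : pset K n) : open_in Z (fun _ => True).
Proof.
exists (fun _ => False); split; last by move=> z _; split=> // _ [].
exists (fun F => F = 1); split=> [F ->|z]; first by exists 0%N; apply: dhomog1.
split=> // -[_ /(_ 1 erefl)]; rewrite /peval meval1 => /eqP.
by rewrite oner_eq0.
Qed.

(** The union of two closed sets is cut out by the products of their equations. *)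
Lemma open_inI {K : fieldType} {n : nat} (Z U V : pset K n) :
  open_in Z U -> open_in Z V -> open_in Z (fun z => U z /\ V z).
Proof.
move=> [C [[E [hE hC]] hU]] [D [[E' [hE' hD]] hV]].
exists (fun z => z != 0 /\ forall F G, E F -> E' G -> peval (F * G) z = 0); split.
  exists (fun H => exists F G, [/\ E F, E' G & H = F * G]); split.
    move=> _ [F [G [/hE [d hF] /hE' [e hG] ->]]].
    by exists (d + e)%N; apply: dhomogM.
  move=> z; split=> -[z0 h]; split=> //; first by move=> _ [F [G [EF EG ->]]]; apply: h.
  by move=> F G EF EG; apply: h; exists F, G.
move=> z Zz; split=> [[/(hU _ Zz) nC /(hV _ Zz) nD] [z0 h]|h].
  apply: nC; apply/hC; split=> // F EF; apply/eqP/negPn/negP => F0.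
  apply: nD; apply/hD; split=> // G EG; apply/eqP.
  by have /eqP := h F G EF EG; rewrite /peval mevalM mulf_eq0 (negPf F0).
split; [apply/(hU _ Zz) => /hC [z0 Cz] | apply/(hV _ Zz) => /hD [z0 Dz]]; apply: h;
  split=> // F G EF EG; rewrite /peval mevalM; apply/eqP; rewrite mulf_eq0.
  by have := Cz F EF; rewrite /peval => ->; rewrite eqxx.
by have := Dz G EG; rewrite /peval => ->; rewrite eqxx orbT.
Qed.

Lemma regular_sub {K : fieldType} {n : nat} (Z U U' : pset K n) f :
  (forall z, Z z -> U' z -> U z) -> regular Z U f -> regular Z U' f.
Proof.
move=> sU rf z Zz U'z; have [V [oV Vz [d [P [Q [hP hQ hf]]]]]] := rf z Zz (sU z Zz U'z).
exists V; split=> //; exists d, P, Q; split=> // w Zw U'w; apply: hf => //.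
exact: sU.
Qed.

Lemma regular_cst {K : fieldType} {n : nat} (Z U : pset K n) (c : K) :
  regular Z U (fun _ => c).
Proof.
move=> z Zz Uz; exists (fun _ => True); split; [exact: open_inT | by [] |].
exists 0%N, c%:MP, 1; split=> [||w _ _ _]; last first.
- by rewrite /peval meval1 mevalC divr1 oner_eq0.
- exact: dhomog1.
by rewrite -[c%:MP]mulr1 mul_mpolyC; apply: rpredZ; apply: dhomog1.
Qed.

Lemma regularM {K : fieldType} {n : nat} (Z U : pset K n) f g :
  regular Z U f -> regular Z U g -> regular Z U (fun z => f z * g z).
Proof.
move=> rf rg z Zz Uz; have [V [oV Vz [d [P [Q [hP hQ hf]]]]]] := rf z Zz Uz.
have [V' [oV' V'z [d' [P' [Q' [hP' hQ' hg]]]]]] := rg z Zz Uz.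
exists (fun z => V z /\ V' z); split=> //; first exact: open_inI.
exists (d + d')%N, (P * P'), (Q * Q'); split; [exact: dhomogM | exact: dhomogM |].
move=> w Zw Uw [Vw V'w]; have [q e] := hf w Zw Uw Vw; have [q' e'] := hg w Zw Uw V'w.
by rewrite /peval !mevalM e e' mulf_div mulf_neq0.
Qed.

Lemma regularX {K : fieldType} {n : nat} (Z U : pset K n) f (d : nat) :
  regular Z U f -> regular Z U (fun z => f z ^+ d).
Proof.
move=> rf; elim: d => [|d ih]; first exact: (regular_cst 1).
move=> z Zz Uz; have [V [oV Vz [e [P [Q [hP hQ hf]]]]]] := regularM rf ih Zz Uz.
by exists V; split=> //; exists e, P, Q; split=> // w; rewrite exprS; apply: hf.
Qed.

(** Near each point, f is given by linear forms up to scaling.  The projections are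
of this kind on the product, and so is the inclusion of a slice; no polynomials of
higher degree are needed. *)
Definition locally_linear {K : fieldType} {m n : nat} (W : pset K m) (Z : pset K n)
    (f : 'rV[K]_m -> 'rV[K]_n) : Prop :=
  forall w, W w -> Z (f w) /\
    exists (T : 'M[K]_(m, n)) (e : nat) (H : {mpoly K[m]}),
      [/\ H \is e.-homog, peval H w != 0 &
          forall w', W w' -> peval H w' != 0 -> same_point (w' *m T) (f w')].

(** Homogeneous equations and quotients of homogeneous polynomials pull back by
substituting the linear forms.  This is valid only where H does not vanish, so the
closed set to be avoided is cut out by the pulled back equations multiplied by
H. *)
Lemma regular_comp {K : fieldType} {m n : nat} (W : pset K m) (Z : pset K n)
    (f : 'rV[K]_m -> 'rV[K]_n) (U : pset K n) (h : 'rV[K]_n -> K) :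
  (forall w, W w -> w != 0) -> (forall z, Z z -> z != 0) -> locally_linear W Z f ->
  regular Z U h -> regular W (fun w => U (f w)) (fun w => h (f w)).
Proof.
move=> W0 Z0 lf rh w Ww Uw; have [Zfw [T [e [H [hH Hw hT]]]]] := lf w Ww.
have [V [[C [[E [hE hC]] hV]] Vw [d [P [Q [hP hQ hPQ]]]]]] := rh _ Zfw Uw.
exists (fun w' => V (f w') /\ peval H w' != 0); split=> //.
  exists (fun w' => w' != 0 /\ forall F, E F -> peval (lsub T^T F * H) w' = 0); split.
    exists (fun G => exists F, E F /\ G = lsub T^T F * H); split.
      move=> _ [F [/hE [k hF] ->]]; exists (k + e)%N.
      by apply: dhomogM => //; apply: lsub_dhomog.
    move=> w'; split=> -[w0 h']; split=> //; first by move=> _ [F [EF ->]]; apply: h'.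
    by move=> F EF; apply: h'; exists F.
  move=> w' Ww'; have [Zw' _] := lf w' Ww'.
  have evM F : peval (lsub T^T F * H) w' = peval F (w' *m T) * peval H w'.
    by rewrite {1}/peval mevalM -!/(peval _ _) peval_lsub.
  split=> [[/(hV _ Zw') nC Hw'] [_ h']|nC].
    apply: nC; apply/hC; split; first exact: Z0.
    move=> F EF; have [k hF] := hE F EF; apply: peval_eq0 hF (hT w' Ww' Hw') _.
    by apply/eqP; have /eqP := h' F EF; rewrite evM mulf_eq0 (negPf Hw') orbF.
  have Hw' : peval H w' != 0.
    apply/eqP => Hw'; apply: nC; split=> [|F EF]; first exact: W0.
    by rewrite evM Hw' mulr0.
  split=> //; apply/(hV _ Zw') => /hC [_ h']; apply: nC; split=> [|F EF]; first exact: W0.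
  have [k hF] := hE F EF; rewrite evM.
  by rewrite (peval_eq0 hF (same_point_sym (hT w' Ww' Hw')) (h' F EF)) mul0r.
exists d, (lsub T^T P), (lsub T^T Q); split; [exact: lsub_dhomog | exact: lsub_dhomog |].
move=> w' Ww' Uw' [Vw' Hw']; have [Zw' _] := lf w' Ww'.
have [q ->] := hPQ _ Zw' Uw' Vw'; rewrite !peval_lsub.
have [c [c0 ec]] := same_point_sym (hT w' Ww' Hw').
rewrite ec (peval_scale _ _ hP) (peval_scale _ _ hQ) -mulf_div divff ?mul1r ?expf_neq0 //.
by rewrite mulf_neq0 ?expf_neq0.
Qed.

(** * Pulling back sections along a map of line bundles *)

(** b is the local expression of a map from the pullback of A to C, so that b^d is
one from the pullback of A^d to C^d. *)
Definition section_pullback {K : fieldType} {m n : nat} (C : cocycle K m) (A : cocycle K n)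
    (o : idx C -> idx A) (f : 'rV[K]_m -> 'rV[K]_n) (b : local_exprs C) (d : nat)
    (t : local_exprs A) : local_exprs C :=
  fun i w => t (o i) (f w) * b i w ^+ d.

(** The map o of charts is part of the data so that the pullback of A need only be
considered on the charts of C; the last condition says that the functions b i glue
to a map of line bundles from the pullback of A to C. *)
Definition bundle_map {K : fieldType} {m n : nat} (W : pset K m) (C : cocycle K m)
    (Z : pset K n) (A : cocycle K n)
    (o : idx C -> idx A) (f : 'rV[K]_m -> 'rV[K]_n) (b : local_exprs C) : Prop :=
  [/\ locally_linear W Z f,
      forall i w, W w -> chart i w -> chart (o i) (f w),
      forall i, regular W (chart i) (b i) &
      forall i j w, W w -> chart i w -> chart j w ->
        trans (o i) (o j) (f w) * b i w = trans i j w * b j w].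

Lemma is_section_pullback {K : fieldType} {m n : nat} (W : pset K m) (C : cocycle K m)
    (Z : pset K n) (A : cocycle K n) (o : idx C -> idx A)
    (f : 'rV[K]_m -> 'rV[K]_n) (b : local_exprs C) (d : nat) (t : local_exprs A) :
  (forall w, W w -> w != 0) -> (forall z, Z z -> z != 0) ->
  bundle_map W Z o f b -> is_section Z (power A d) t ->
  is_section W (power C d) (section_pullback o f b d t).
Proof.
move=> W0 Z0 [lf hch rb hb] [rt ht]; split=> [i|i j w Ww ci cj].
  apply: (@regularM _ _ W _ (fun w => t (o i) (f w)) (fun w => b i w ^+ d)); last first.
    by apply: regularX; apply: rb.
  by apply: regular_sub (regular_comp W0 Z0 lf (rt (o i))) => w Ww; apply: hch.
have [Zw _] := lf w Ww.
rewrite /section_pullback (ht (o i) (o j)) //=; try exact: hch.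
by rewrite mulrAC -exprMn hb // exprMn mulrAC mulrA.
Qed.

Lemma augmentation_row {K : fieldType} {n r q : nat} (A : cocycle K n)
    (s : 'I_r -> local_exprs A) (E : free_complex K r) (g : 'I_(rk E 0) -> local_exprs A)
    (v : 'rV_q) (N : 'M_(q, rk E 0)) i z :
  augmentation s g (v *m N) i z =
  \sum_j (v 0 j).@[fun k => s k i z] * augmentation s g (row j N) i z.
Proof.
rewrite /augmentation; under eq_bigr => k _ do
  rewrite mxE raddf_sum /= big_distrl /=.
rewrite exchange_big /=; apply: eq_bigr => j _; rewrite big_distrr /=.
by apply: eq_bigr => k _; rewrite mxE mevalM mulrA.
Qed.

(** The images of the generators of E_0 lift to F_0 because F_0 maps onto the sections
of C.  The square then commutes because the coefficient of a generator of degree e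
in an element of degree d is homogeneous of degree d - e: evaluating it at the
pulled back sections, which carry a factor b, brings out b^(d - e), which
completes the factor b^e of the generator. *)
Lemma section_pullback_lift {K : fieldType} {m n r q : nat}
    (W : pset K m) (C : cocycle K m) (Z : pset K n) (A : cocycle K n)
    (o : idx C -> idx A) (f : 'rV[K]_m -> 'rV[K]_n) (b : local_exprs C)
    (s : 'I_r -> local_exprs A) (E : free_complex K r) (g : 'I_(rk E 0) -> local_exprs A)
    (u : 'I_q -> local_exprs C) (F : free_complex K q) (h : 'I_(rk F 0) -> local_exprs C)
    (B : 'M[K]_(r, q)) :
  (forall w, W w -> w != 0) -> (forall z, Z z -> z != 0) ->
  bundle_map W Z o f b ->
  minimal_resolution Z s g -> minimal_resolution W u h ->
  (forall k, eq_section W (section_pullback o f b 1 (s k)) (lincomb (B k) u)) ->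
  exists N : 'M_(rk E 0, rk F 0),
    [/\ graded_mx (@twist _ _ E 0) (@twist _ _ F 0) N,
        forall j, eq_section W (section_pullback o f b (twist j) (g j))
                    (augmentation u h (row j N)) &
        forall d v, homog_elt (E := E) d v ->
          eq_section W (augmentation u h (map_mx (lsub B) v *m N))
                       (section_pullback o f b d (augmentation s g v))].
Proof.
move=> W0 Z0 bm [_ [_ [secg _]]] [_ [_ [_ [_ [surj _]]]]] hB.
have /fin_all_exists [N hN] : forall j : 'I_(rk E 0), exists v : 'rV_(rk F 0),
    homog_elt (E := F) (twist j) v /\
    eq_section W (section_pullback o f b (twist j) (g j)) (augmentation u h v).
  by move=> j; apply: surj; apply: is_section_pullback (secg j).
exists (\matrix_j N j); split=> [j k|j|d v hv i w Ww ci].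
- by rewrite mxE; have [hj _] := hN j.
- by rewrite rowK; have [_] := hN j.
rewrite augmentation_row /section_pullback /augmentation big_distrl /=.
apply: eq_bigr => j _; rewrite rowK mxE lsub_meval -/(augmentation _ _ _ _ _).
have [_ /(_ i w Ww ci) <-] := hN j; rewrite /section_pullback.
under meval_eq => k.
  have := hB k i w Ww ci; rewrite /section_pullback /lincomb expr1 mulrC => <-.
  over.
have /twist_homogP := hv j; case: leqP => [jd hj|_ /eqP ->]; last first.
  by rewrite !meval0 !mul0r.
rewrite (meval_dhomog _ _ hj) -{2}(subnK jd) exprD; ring.
Qed.

(** * Section rings that are retracts *)

Lemma augmentation_diff {K : fieldType} {n r : nat} (Z : pset K n) (A : cocycle K n)
    (s : 'I_r -> local_exprs A) (E : free_complex K r) (g : 'I_(rk E 0) -> local_exprs A) j :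
  minimal_resolution Z s g ->
  eq_section Z (augmentation s g (row j (diff E 0))) (fun _ _ => 0).
Proof.
move=> [_ [gr [_ [_ [_ [ex _]]]]]].
apply/(ex (twist j) (row j (diff E 0))); first by apply: graded_row; apply: gr.
exists (row j 1%:M); split; first exact: graded_row (graded_mx1 _).
by rewrite -row_mul mul1mx.
Qed.

Lemma augmentation_lift {K : fieldType} {n r q : nat} (Z : pset K n) (A : cocycle K n)
    (s : 'I_r -> local_exprs A) (E : free_complex K r) (g : 'I_(rk E 0) -> local_exprs A)
    (a : 'I_q -> nat) (N : 'M_(q, rk E 0)) :
  minimal_resolution Z s g -> graded_mx a (@twist _ _ E 0) N ->
  (forall j, eq_section Z (augmentation s g (row j N)) (fun _ _ => 0)) ->
  exists U, graded_mx a (@twist _ _ E 1) U /\ N = U *m diff E 0.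
Proof.
move=> [_ [_ [_ [_ [_ [ex _]]]]]] hN N0; apply: lift_rows => j.
by apply/(ex _ _ (graded_row hN)).
Qed.

Lemma minimal_resolution_complex {K : fieldType} {n r : nat} (Z : pset K n) (A : cocycle K n)
    (s : 'I_r -> local_exprs A) (E : free_complex K r) (g : 'I_(rk E 0) -> local_exprs A) :
  minimal_resolution Z s g -> exact_complex E /\ minimal_complex E.
Proof. by move=> [_ [gr [_ [mi [_ [_ ex]]]]]]. Qed.

Lemma section_pullback_basis {K : fieldType} {m n r q : nat}
    (W : pset K m) (C : cocycle K m) (Z : pset K n) (A : cocycle K n)
    (o : idx C -> idx A) (f : 'rV[K]_m -> 'rV[K]_n) (b : local_exprs C)
    (s : 'I_r -> local_exprs A) (u : 'I_q -> local_exprs C) :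
  (forall w, W w -> w != 0) -> (forall z, Z z -> z != 0) -> bundle_map W Z o f b ->
  section_basis Z s -> section_basis W u ->
  exists B : 'M[K]_(r, q),
    forall k, eq_section W (section_pullback o f b 1 (s k)) (lincomb (B k) u).
Proof.
move=> W0 Z0 bm [secs _ _] [_ span _].
have /fin_all_exists [B hB] : forall k, exists c : 'I_q -> K,
    eq_section W (section_pullback o f b 1 (s k)) (lincomb c u).
  move=> k; apply: span.
  exact: (is_section_pullback (d := 1) W0 Z0 bm (secs k)).
exists (\matrix_(k, l) B k l) => k i w Ww ci; rewrite (hB k i w Ww ci).
by apply: eq_bigr => l _; rewrite mxE.
Qed.

(** The degrees of the generators of a minimal resolution of a section ring occur in
a minimal resolution of any section ring of which it is a retract. *)
Theorem twist_of_retract {K : fieldType} {m n r q : nat}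
    (W : pset K m) (C : cocycle K m) (Z : pset K n) (A : cocycle K n)
    (o : idx C -> idx A) (f : 'rV[K]_m -> 'rV[K]_n) (b : local_exprs C)
    (o' : idx A -> idx C) (f' : 'rV[K]_n -> 'rV[K]_m) (b' : local_exprs A)
    (s : 'I_r -> local_exprs A) (E : free_complex K r) (g : 'I_(rk E 0) -> local_exprs A)
    (u : 'I_q -> local_exprs C) (F : free_complex K q) (h : 'I_(rk F 0) -> local_exprs C) :
  (forall w, W w -> w != 0) -> (forall z, Z z -> z != 0) ->
  bundle_map W Z o f b -> bundle_map Z W o' f' b' ->
  (forall d (t : local_exprs A), is_section Z (power A d) t ->
     eq_section Z (section_pullback o' f' b' d (section_pullback o f b d t)) t) ->
  section_basis Z s -> minimal_resolution Z s g ->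
  section_basis W u -> minimal_resolution W u h ->
  forall i (j : 'I_(rk E i)), exists k : 'I_(rk F i), twist k = twist j.
Proof.
move=> W0 Z0 bm bm' rt bs rs bu ru i j.
have [B hB] := section_pullback_basis W0 Z0 bm bs bu.
have [B' hB'] := section_pullback_basis Z0 W0 bm' bu bs.
have [secs _ free] := bs.
have [exE minE] := minimal_resolution_complex rs.
have [exF _] := minimal_resolution_complex ru.
have [lf' hch' _ _] := bm'.
have BB' : B *m B' = 1%:M.
  apply/matrixP => k l; apply/eqP; rewrite -subr_eq0; apply/eqP; move: l.
  (* The composite fixes the basis s, whose elements are independent. *)
  apply: free => x z Zz cx; have [Wz _] := lf' z Zz.
  transitivity (section_pullback o' f' b' 1 (section_pullback o f b 1 (s k)) x z - s k x z);
    last by rewrite (rt 1%N (s k) (secs k) x z Zz cx) subrr.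
  rewrite /lincomb; under eq_bigr => l _ do rewrite mulrBl.
  rewrite sumrB; congr (_ - _).
    rewrite {1}/section_pullback (hB k _ _ Wz (hch' x z Zz cx)) /lincomb big_distrl /=.
    under eq_bigr => l _ do rewrite mxE big_distrl /=.
    rewrite exchange_big /=; apply: eq_bigr => l _.
    have := hB' l x z Zz cx; rewrite /section_pullback /lincomb -mulrA => ->.
    by rewrite big_distrr /=; apply: eq_bigr => t _; rewrite mulrA.
  rewrite (bigD1 k) //= big1 ?addr0 ?mxE ?eqxx ?mul1r // => l lk.
  by rewrite mxE eq_sym (negPf lk) mul0r.
have [N [grN augN pN]] := section_pullback_lift W0 Z0 bm rs ru hB.
have [N' [grN' _ pN']] := section_pullback_lift Z0 W0 bm' ru rs hB'.
have kerN : exists U, graded_mx (@twist _ _ E 1) (@twist _ _ F 1) U /\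
    map_mx (lsub B) (diff E 0) *m N = U *m diff F 0.
  have [grE _] := exE; apply: (augmentation_lift ru).
    exact: graded_mxM (graded_mx_lsub (grE 0%N)) grN.
  move=> k x w Ww cx; rewrite row_mul -map_row.
  rewrite (pN (twist k) _ (graded_row (grE 0%N)) x w Ww cx) /section_pullback.
  have [lf hch _ _] := bm; have [Zw _] := lf w Ww.
  by rewrite (augmentation_diff k rs) ?mul0r //; apply: hch.
have kerN' : exists U, graded_mx (@twist _ _ F 1) (@twist _ _ E 1) U /\
    map_mx (lsub B') (diff F 0) *m N' = U *m diff E 0.
  have [grF _] := exF; apply: (augmentation_lift rs).
    exact: graded_mxM (graded_mx_lsub (grF 0%N)) grN'.
  move=> k x w Ww cx; rewrite row_mul -map_row.
  rewrite (pN' (twist k) _ (graded_row (grF 0%N)) x w Ww cx) /section_pullback.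
  have [Zw _] := lf' w Ww.
  by rewrite (augmentation_diff k ru) ?mul0r //; apply: hch'.
have htpy : exists U, graded_mx (@twist _ _ E 0) (@twist _ _ E 1) U /\
    1%:M - map_mx (lsub B') N *m N' = U *m diff E 0.
  apply: (augmentation_lift rs).
    exact: graded_mxB (graded_mx1 _) (graded_mxM (graded_mx_lsub grN) grN').
  move=> k x z Zz cx; have [Wz _] := lf' z Zz.
  have [_ [_ [secg _]]] := rs.
  have -> : augmentation s g (row k (1%:M - map_mx (lsub B') N *m N')) x z =
      g k x z - augmentation s g (row k (map_mx (lsub B') N *m N')) x z.
    rewrite /augmentation; under eq_bigr => l _ do rewrite !mxE mevalB mulrBl.
    rewrite sumrB; congr (_ - _).
      rewrite (bigD1 k) //= big1 ?addr0 ?eqxx ?meval1 ?mul1r // => l lk.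
      by rewrite eq_sym (negPf lk) meval0 mul0r.
    by apply: eq_bigr => l _; rewrite !mxE.
  rewrite row_mul -map_row (pN' (twist k) _ (graded_row grN) x z Zz cx).
  rewrite /section_pullback -(augN k _ _ Wz (hch' x z Zz cx)).
  have := rt (twist k) (g k) (secg k) x z Zz cx; rewrite {1}/section_pullback => ->.
  by rewrite subrr.
apply: (@retract_twist _ _ _ E F B B' i j minE).
elim: i {j} => [|i ih]; last exact: retract_step ih.
have [U [grU eU]] := kerN; have [U' [grU' eU']] := kerN'; have [V [grV eV]] := htpy.
exists N, U, N', U', V, 0; split=> //; first by rewrite addr0.
by split=> [|k l]; rewrite ?mulmx0 // mxE mcoeff0.
Qed.

(** * The product with a point and the projections *)

Lemma segre_neq0 {K : fieldType} {m n : nat} (x : 'rV[K]_m) (y : 'rV[K]_n) :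
  x != 0 -> y != 0 -> mxvec (x^T *m y) != 0.
Proof.
move=> /rV0Pn [i xi] /rV0Pn [j yj]; apply/rV0Pn; exists (mxvec_index i j).
by rewrite mxvecE mxE big_ord1 mxE mulf_neq0.
Qed.

(** Where the entry (i, j) of w does not vanish, the j-th column of w represents the
first projection. *)
Lemma proj_fst_locally_linear {K : fieldType} {m n : nat} (X : pset K m) (Y : pset K n) :
  zclosed X -> zclosed Y -> locally_linear (segre_product X Y) X proj_fst.
Proof.
move=> cX cY w [x [y [Xx Yy ->]]].
have x0 := zclosed_neq0 cX Xx; have y0 := zclosed_neq0 cY Yy.
split; first exact: zclosed_same_point cX (proj_fst_segre x0 y0) Xx.
have /rV0Pn [i xi] := x0; have /rV0Pn [j yj] := y0.
exists (\matrix_(k, i') (k == mxvec_index i' j)%:R), 1%N, 'X_(mxvec_index i j); split.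
- by rewrite dhomogX /= mdeg1.
- by rewrite /peval mevalXU mxvecE mxE big_ord1 mxE mulf_neq0.
move=> _ [x' [y' [Xx' Yy' ->]]]; rewrite /peval mevalXU mxvecE mxE big_ord1 mxE => ne.
have [c [c0 ->]] := proj_fst_segre (zclosed_neq0 cX Xx') (zclosed_neq0 cY Yy').
move: ne; rewrite mulf_eq0 negb_or => /andP [_ y'j].
exists (c / y' 0 j); split; first by rewrite mulf_neq0 ?invr_eq0.
have -> : mxvec (x'^T *m y') *m (\matrix_(k, i') (k == mxvec_index i' j)%:R) = y' 0 j *: x'.
  apply/rowP => i'; rewrite !mxE (bigD1 (mxvec_index i' j)) //= big1 ?addr0.
    by rewrite mxvecE !mxE big_ord1 !mxE eqxx mulr1 mulrC.
  by move=> k /negPf kn; rewrite !mxE kn mulr0.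
by rewrite scalerA mulfVK.
Qed.

Lemma proj_snd_locally_linear {K : fieldType} {m n : nat} (X : pset K m) (Y : pset K n) :
  zclosed X -> zclosed Y -> locally_linear (segre_product X Y) Y proj_snd.
Proof.
move=> cX cY w [x [y [Xx Yy ->]]].
have x0 := zclosed_neq0 cX Xx; have y0 := zclosed_neq0 cY Yy.
split; first exact: zclosed_same_point cY (proj_snd_segre x0 y0) Yy.
have /rV0Pn [i xi] := x0; have /rV0Pn [j yj] := y0.
exists (\matrix_(k, j') (k == mxvec_index i j')%:R), 1%N, 'X_(mxvec_index i j); split.
- by rewrite dhomogX /= mdeg1.
- by rewrite /peval mevalXU mxvecE mxE big_ord1 mxE mulf_neq0.
move=> _ [x' [y' [Xx' Yy' ->]]]; rewrite /peval mevalXU mxvecE mxE big_ord1 mxE => ne.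
have [c [c0 ->]] := proj_snd_segre (zclosed_neq0 cX Xx') (zclosed_neq0 cY Yy').
move: ne; rewrite mulf_eq0 negb_or => /andP [x'i _].
exists (c / x' 0 i); split; first by rewrite mulf_neq0 ?invr_eq0.
have -> : mxvec (x'^T *m y') *m (\matrix_(k, j') (k == mxvec_index i j')%:R) = x' 0 i *: y'.
  apply/rowP => j'; rewrite !mxE (bigD1 (mxvec_index i j')) //= big1 ?addr0.
    by rewrite mxvecE !mxE big_ord1 !mxE eqxx mulr1.
  by move=> k /negPf kn; rewrite !mxE kn mulr0.
by rewrite scalerA mulfVK.
Qed.

Lemma slice_locally_linear {K : fieldType} {m n : nat} (X : pset K m) (Y : pset K n) y :
  Y y -> locally_linear X (segre_product X Y) (fun x => mxvec (x^T *m y)).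
Proof.
move=> Yy x Xx; split; first by exists x, y.
exists (\matrix_i mxvec ((delta_mx i 0 : 'cV_m) *m y)), 0%N, 1; split.
- exact: dhomog1.
- by rewrite /peval meval1 oner_eq0.
move=> x' _ _; exists 1; split; first exact: oner_neq0.
rewrite scale1r; apply/rowP => k; case/mxvec_indexP: k => i j.
rewrite mxvecE !mxE big_ord1 (bigD1 i) //= big1 ?addr0.
  by rewrite !mxE mxvecE !mxE big_ord1 !mxE !eqxx mul1r.
move=> l /negPf li; rewrite !mxE mxvecE !mxE big_ord1 !mxE eq_sym li.
by rewrite mul0r mulr0.
Qed.

(** The sections of a very ample bundle have no common zero, as they are the
homogeneous coordinates of a point of projective space. *)
Lemma very_ample_section {K : fieldType} {n : nat} (Y : pset K n) (M : cocycle K n) y j :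
  very_ample Y M -> Y y -> chart j y ->
  exists b : local_exprs M, is_section Y M b /\ b j y = 1.
Proof.
move=> [r [s [f [[secs _ _] hf [cl _ _]]]]] Yy cy.
have fy0 : f y != 0.
  apply: zclosed_neq0 cl _; exists y; split=> //.
  by exists 1; rewrite oner_neq0 scale1r.
have [c [c0 ef]] := same_point_sym (hf j y Yy cy).
have /rV0Pn [k sk] : \row_k s k j y != 0 by rewrite ef scaler_eq0 negb_or c0.
rewrite mxE in sk; have [rs cs] := secs k.
exists (fun i z => (s k j y)^-1 * s k i z); split; last by rewrite mulVf.
split=> [i|i i' z Yz ci ci'].
  by apply: (@regularM _ _ Y _ (fun _ => (s k j y)^-1) (s k i)) => //; apply: regular_cst.
by rewrite (cs i i' z Yz ci ci') mulrCA.
Qed.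

(** The first map of bundles multiplies by the section b of M, the second one
restricts to the slice through y, in the chart j0 of M around y. *)
Theorem property_N_segre_factor {K : fieldType} {m n : nat}
    (X : pset K m) (Y : pset K n) (L : cocycle K m) (M : cocycle K n) (p : nat) :
  zclosed X -> projective_variety Y -> line_bundle X L -> line_bundle Y M ->
  property_N 0 X L -> very_ample Y M ->
  property_N p (segre_product X Y) (tensor (pullback proj_fst L) (pullback proj_snd M)) ->
  property_N p X L.
Proof.
move=> cX [cY [[y Yy] _]] lbL lbM [vaL [r [s [E [g [bs rs gen0 _]]]]]] vaM.
move=> [_ [q [u [F [h [bu ru _ linF]]]]]].
split=> //; exists r, s, E, g; split=> // i ip j.
have [openL _ regL _ _] := lbL; have [openM coverM _ oneM _] := lbM.
have [j0 cy] := coverM y Yy.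
have [b [[regb cob] b1]] := very_ample_section vaM Yy cy.
have X0 x : X x -> x != 0 by exact: zclosed_neq0.
have Y0 z : Y z -> z != 0 by exact: zclosed_neq0.
have W0 w : segre_product X Y w -> w != 0.
  by move=> [x [z [Xx Yz ->]]]; apply: segre_neq0; [apply: X0 | apply: Y0].
have lf := proj_fst_locally_linear cX cY; have ls := proj_snd_locally_linear cX cY.
have lsl := @slice_locally_linear _ _ _ X Y y Yy.
pose C := tensor (pullback proj_fst L) (pullback proj_snd M).
have bm : bundle_map (C := C) (segre_product X Y) X (A := L) (fun i => i.1) proj_fst
    (fun i w => b i.2 (proj_snd w)).
  split=> // [k w _ []//|k|k l w Ww [ck dk] [cl dl]].
    by apply: regular_sub (regular_comp W0 Y0 ls (regb k.2)) => w _ [].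
  have [Yw _] := ls w Ww.
  by rewrite /= (cob k.2 l.2 _ Yw dk dl) mulrA.
have sf x : X x -> same_point x (proj_fst (mxvec (x^T *m y))).
  by move=> Xx; apply: proj_fst_segre; [apply: X0 | apply: Y0].
have ss x : X x -> same_point y (proj_snd (mxvec (x^T *m y))).
  by move=> Xx; apply: proj_snd_segre; [apply: X0 | apply: Y0].
have Xf x : X x -> X (proj_fst (mxvec (x^T *m y))).
  by move=> Xx; apply: zclosed_same_point cX (sf x Xx) Xx.
have Ys x : X x -> Y (proj_snd (mxvec (x^T *m y))).
  by move=> Xx; apply: zclosed_same_point cY (ss x Xx) Yy.
have cf (k : idx L) x : X x -> chart k x -> chart k (proj_fst (mxvec (x^T *m y))).
  by move=> Xx; apply: (open_same_point (openL k) (sf x Xx) Xx (Xf x Xx)).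
have cs x : X x -> @chart _ _ M j0 (proj_snd (mxvec (x^T *m y))).
  by move=> Xx; apply: (open_same_point (openM j0) (ss x Xx) Yy (Ys x Xx) cy).
have bm' : bundle_map (C := L) X (segre_product X Y) (A := C) (fun k => (k, j0))
    (fun x => mxvec (x^T *m y)) (fun _ _ => 1).
  split=> // [k x Xx ck|k|k l x Xx ck cl].
  - by split; [apply: cf | apply: cs].
  - exact: regular_cst.
  rewrite /= !mulr1 oneM ?mulr1; [|exact: Ys | exact: cs].
  apply/esym/(regular_same_point (regL k l) (sf x Xx) Xx (Xf x Xx)); first by [].
  by split; apply: cf.
have rt d (t : local_exprs L) : is_section X (power L d) t ->
    eq_section X (section_pullback (C := L) (A := C) (fun k => (k, j0))
        (fun x => mxvec (x^T *m y)) (fun _ _ => 1) d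
      (section_pullback (C := C) (A := L) (fun i => i.1) proj_fst
        (fun i w => b i.2 (proj_snd w)) d t)) t.
  move=> [rt _] k x Xx ck; rewrite /section_pullback /= expr1n mulr1.
  rewrite -(regular_same_point (regb j0) (ss x Xx) Yy (Ys x Xx) cy (cs x Xx)) b1 expr1n mulr1.
  by apply/esym/(regular_same_point (rt k) (sf x Xx) Xx (Xf x Xx)) => //; apply: cf.
have [k <-] := twist_of_retract W0 X0 bm bm' rt bs rs bu ru j.
exact: linF.
Qed.

Unset Implicit Arguments.

Theorem proposition7 (R : realType) (m n : nat)
    (X : pset R[i] m) (Y : pset R[i] n)
    (L : cocycle R[i] m) (M : cocycle R[i] n) (p : nat) :
  smooth_projective_variety X -> smooth_projective_variety Y ->
  line_bundle X L -> line_bundle Y M ->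
  property_N 1 X L -> property_N 1 Y M ->
  (2 <= p)%N ->
  ~ property_N p X L ->
  ~ property_N p (segre_product X Y)
      (tensor (pullback proj_fst L) (pullback proj_snd M)).
Proof.
move=> [[cX _] _] [pY _] lbL lbM [vaL [r [s [E [g [bs rs gen _]]]]]] [vaM _] _ nL.
move/(property_N_segre_factor cX pY lbL lbM) => nLM; apply: nL.
by apply: nLM => //; split=> //; exists r, s, E, g; split=> // i /andP [/leq_trans le /le].
Qed.
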